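(* For every $d \in \mathbb{N}$ with $d \geq 4$ and every $f \in \ell^2(\mathbb{Z}^d)$, $$\Big\| \sup_{t \in \mathbb{D},\ t \leq \sqrt{d}} |\mathcal{M}_t f| \Big\|_{\ell^2(\mathbb{Z}^d)} \leq 40\, \| f \|_{\ell^2(\mathbb{Z}^d)} .$$
   Context: $\mathbb{N}=\{1,2,\dots\}$, $\mathbb{N}_0=\mathbb{N}\cup\{0\}$, and $\mathbb{D}=\{2^n : n\in\mathbb{N}_0\}$ is the set of dyadic integers. For $t>0$, $B_t=\{x\in\mathbb{R}^d : \sum_{i=1}^d |x_i|\le t\}$. For $f:\mathbb{Z}^d\to\mathbb{C}$, the discrete Hardy-Littlewood averaging operator is $$\mathcal{M}_t f(x)=\frac{1}{|B_t\cap\mathbb{Z}^d|}\sum_{y\in B_t\cap\mathbb{Z}^d} f(x-y),\qquad x\in\mathbb{Z}^d,$$ where $|A|$ denotes the number of elements of a finite set $A$. *)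

(* Defs.v *)
From HB Require Import structures.
From mathcomp Require Import all_boot all_order all_algebra.
From mathcomp Require Import finmap complex.
From mathcomp Require Import all_classical all_reals all_analysis.
From mathcomp Require Import zify.

Set Implicit Arguments.
Unset Strict Implicit.
Unset Printing Implicit Defensive.

Import Order.TTheory GRing.Theory Num.Theory.
Import numFieldNormedType.Exports.

Local Open Scope classical_set_scope.
Local Open Scope ring_scope.

Notation Zd d := 'rV[int]_d.

(* The R-valued modulus: the generic norm `|z| of R[i] lives in R[i]. *)
Notation Cmod := ComplexField.Normc.normc.

Definition dyadic (R : realType) : set R := [set t | exists n : nat, t = 2 ^+ n].

Definition l1ball (R : realType) (d : nat) (t : R) : set 'rV[R]_d :=
  [set x | \sum_(i < d) `|x ord0 i| <= t].

(* B_t `&` Z^d, with Z^d embedded in R^d coordinatewise. *)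
Definition lattice_ball (R : realType) (d : nat) (t : R) : set (Zd d) :=
  [set y | l1ball t (map_mx intr y)].
Arguments lattice_ball {R} d t.

(* fset_set and the finitely supported sum below return a default value on
   infinite sets; this rules that case out. *)
Lemma finite_lattice_ball (R : realType) (d : nat) (t : R) :
  finite_set (lattice_ball d t).
Proof.
pose N := Num.bound t.
have tN y i : lattice_ball d t y -> (`|y ord0 i|%N < N)%N.
  rewrite /lattice_ball/= /l1ball/= => yt.
  have: `|(y ord0 i)%:~R| <= t :> R.
    apply: le_trans yt; rewrite (bigD1 i)//= mxE lerDl.
    by apply: sumr_ge0 => j _; exact: normr_ge0.
  move=> yit; have t0 : 0 <= t by apply: le_trans yit; exact: normr_ge0.
  have := le_lt_trans yit (archi_boundP t0).
  by rewrite -intr_norm -abszE -[_%:~R]/(`|y ord0 i|%N%:R) ltr_nat.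
pose g (u : {ffun 'I_d -> 'I_(N + N)}) : Zd d :=
  \row_i ((u i)%:Z - N%:Z).
apply: (@sub_finite_set _ _ [set g u | u in [set: {ffun 'I_d -> 'I_(N + N)}]]);
  last exact/finite_image/finite_finset.
move=> y yt.
have lt_i i : (`|(y ord0 i + N%:Z)%R|%N < N + N)%N by have := tN y i yt; lia.
exists [ffun i => Ordinal (lt_i i)] => //.
apply/rowP => i; rewrite mxE ffunE /=; have := tN y i yt.
by rewrite (ord1 0); lia.
Qed.

Definition average (R : realType) (d : nat) (t : R) (f : Zd d -> R[i])
    (x : Zd d) : R[i] :=
  (#|` fset_set (lattice_ball d t)|%fset%:R)^-1
    * \sum_(y \in lattice_ball d t) f (x - y).

Definition dyadic_maximal (R : realType) (d : nat) (f : Zd d -> R[i])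
    (x : Zd d) : R :=
  sup [set Cmod (average t f x)
      | t in [set t : R | dyadic t /\ t <= Num.sqrt d%:R]].

(* The +oo-valued l^2 norm. *)
Definition l2norm (R : realType) (T : choiceType) (f : T -> R[i]) : \bar R :=
  sqrte (\esum_(x in [set: T]) ((Cmod (f x) ^+ 2)%:E)).

Definition in_l2 (R : realType) (T : choiceType) (f : T -> R[i]) : Prop :=
  (l2norm f < +oo)%E.

(* The supremum in dyadic_maximal is a genuine one: sup defaults to 0 otherwise. *)
Lemma dyadic_maximal_has_sup (R : realType) (d : nat) (f : Zd d -> R[i])
    (x : Zd d) : (0 < d)%N ->
  has_sup [set Cmod (average t f x)
          | t in [set t : R | dyadic t /\ t <= Num.sqrt d%:R]].
Proof.
move=> d0; split.
  exists (Cmod (average (1 : R) f x)); exists 1 => //; split.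
    by exists 0%N; rewrite expr0.
  by rewrite -[leLHS]sqrtr1 ler_wsqrtr// ler1n.
pose N := Num.bound (Num.sqrt d%:R : R).
exists (\sum_(n < N) Cmod (average (2 ^+ n : R) f x)) => _ [t [[n ->] tn] <-].
have nN : (n < N)%N.
  have := le_lt_trans tn (archi_boundP (sqrtr_ge0 (d%:R : R))).
  by rewrite -natrX ltr_nat; apply: ltn_trans; exact: ltn_expl.
rewrite (bigD1 (Ordinal nN))//= lerDl; apply: sumr_ge0 => i _.
by case: (average _ _ _) => a b; rewrite sqrtr_ge0.
Qed.

(* Main.v *)
Require Import Defs.
From HB Require Import structures.
From mathcomp Require Import all_boot all_order all_algebra.
From mathcomp Require Import finmap complex.
From mathcomp Require Import all_classical all_reals all_analysis.
From mathcomp Require Import zify ring lra.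

(* For N <= sqrt d most points of B_N have exactly N nonzero coordinates, all
   equal to 1 or -1, and each such point is the endpoint of N! paths of the
   simple random walk A on Z^d. Counting gives, for f >= 0, the pointwise bound
   M_N f <= 2 A^N f + E_N f, where the operator norm of E_N is at most N^2 / d.
   Since N is dyadic, the errors are summable in square.

   It remains to bound sup_k A^(2^(k+1)) f. With P = A^2, the power P^(2^k) is
   compared to the Cesaro mean S_k of P^0, ..., P^(2^k - 1). The square function
   of P^(2^k) - S_k is controlled by telescoping, as j |-> <P^j f, f> is
   decreasing and convex. The maximal function of S_k is bounded by a TT*
   argument resting on S_j S_k <= 2 S_(k+1) for j <= k.

   All of this is done on a finite quotient of Z^d, which is indistinguishable
   from Z^d on a large box. *)

Set Implicit Arguments.
Unset Strict Implicit.
Unset Printing Implicit Defensive.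

Import Order.TTheory GRing.Theory Num.Theory.
Import numFieldNormedType.Exports.

Local Open Scope ring_scope.

(** * Finite sums *)

Lemma ler_of_sqr (R : realFieldType) (a b : R) : 0 <= b -> a ^+ 2 <= b ^+ 2 -> a <= b.
Proof. by move=> b0 ab; rewrite leNgt; apply/negP => ba; nra. Qed.

Lemma cauchy_schwarz_sum (R : realFieldType) (I : Type) (s : seq I) (a b : I -> R) :
  (\sum_(i <- s) a i * b i) ^+ 2
    <= (\sum_(i <- s) a i ^+ 2) * (\sum_(i <- s) b i ^+ 2).
Proof.
elim: s => [|i s IH]; first by rewrite !big_nil expr0n mulr0.
rewrite !big_cons.
have A0 : 0 <= \sum_(i <- s) a i ^+ 2 by apply: sumr_ge0 => j _; exact: sqr_ge0.
have B0 : 0 <= \sum_(i <- s) b i ^+ 2 by apply: sumr_ge0 => j _; exact: sqr_ge0.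
move: IH A0 B0; set S := \sum_(i <- s) _; set A := \sum_(i <- s) _.
set B := \sum_(i <- s) _; move: (a i) (b i) => x y SAB A0 B0.
suff: 2 * (S * (x * y)) <= A * y ^+ 2 + B * x ^+ 2 by nra.
apply: ler_of_sqr; first by rewrite addr_ge0// mulr_ge0// sqr_ge0.
apply: (@le_trans _ _ (4 * ((A * B) * (x * y) ^+ 2))).
  by rewrite !exprMn; have := ler_wpM2r (sqr_ge0 (x * y)) SAB; rewrite exprMn; lra.
by have := sqr_ge0 (A * y ^+ 2 - B * x ^+ 2); lra.
Qed.

Lemma sqr_sum_le (R : realFieldType) (I : Type) (s : seq I) (a : I -> R) :
  (\sum_(i <- s) a i) ^+ 2 <= (size s)%:R * \sum_(i <- s) a i ^+ 2.
Proof.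
have := cauchy_schwarz_sum s (fun=> 1) a.
under eq_bigr do rewrite mul1r; under [X in _ <= X * _]eq_bigr do rewrite expr1n.
by rewrite big_const_seq count_predT iter_addr_0.
Qed.

Lemma dyadic_tail_sum (R : realFieldType) m K : (0 < m)%N ->
  \sum_(k < K | (m <= 2 ^ k)%N) (2 ^+ k)^-1 <= 2 / m%:R :> R.
Proof.
move=> m0.
have m0' : 0 < m%:R :> R by rewrite ltr0n.
(* While 2^K < m the sum is empty; from then on the induction carries the missing tail 2 / 2^K. *)
have [S_lt S_ge] : ((2 ^ K < m)%N ->
    \sum_(k < K | (m <= 2 ^ k)%N) (2 ^+ k)^-1 = 0 :> R) /\
  ((m <= 2 ^ K)%N ->
    \sum_(k < K | (m <= 2 ^ k)%N) (2 ^+ k)^-1 <= 2 / m%:R - 2 / 2 ^+ K :> R).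
  elim: K => [|K [IH1 IH2]].
    split; first by rewrite big_ord0.
    by move=> m1; have -> : m = 1%N by [lia]; rewrite big_ord0 subrr.
  have K0 : 0 < 2 ^+ K :> R by rewrite exprn_gt0.
  split => mK.
    have lt : (2 ^ K < m)%N by apply: leq_ltn_trans mK; rewrite leq_exp2l.
    by rewrite big_mkcond big_ord_recr/= -big_mkcond/= IH1// leqNgt lt addr0.
  rewrite big_mkcond big_ord_recr/= -big_mkcond/= exprS invfM mulrA divff ?pnatr_eq0// mul1r.
  case: leqP => [le|lt].
    by have := IH2 le; lra.
  rewrite IH1// addr0 subr_ge0 ler_pdivlMr// ler_pdivrMl//.
  by rewrite -natrX -natrM ler_nat mulnC -expnS.
have K0 : 0 < 2 ^+ K :> R by rewrite exprn_gt0.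
case: (leqP m (2 ^ K)) => [/S_ge|/S_lt ->].
  by move/le_trans; apply; rewrite gerBl divr_ge0// ltW.
by rewrite divr_ge0// ltW.
Qed.

Definition dot {R : realFieldType} {T : finType} (f g : T -> R) : R :=
  \sum_x f x * g x.

Section Dot.
Context {R : realFieldType} {T : finType}.
Implicit Types f g h : T -> R.

Lemma dotC f g : dot f g = dot g f.
Proof. by apply: eq_bigr => x _; rewrite mulrC. Qed.

Lemma dot_sqr f : dot f f = \sum_x f x ^+ 2.
Proof. by apply: eq_bigr => x _; rewrite expr2. Qed.

Lemma dot_sqr_ge0 f : 0 <= dot f f.
Proof. by rewrite dot_sqr; apply: sumr_ge0 => x _; exact: sqr_ge0. Qed.

Lemma dot_ge0 f g : (forall x, 0 <= f x) -> (forall x, 0 <= g x) -> 0 <= dot f g.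
Proof. by move=> f0 g0; apply: sumr_ge0 => x _; exact: mulr_ge0. Qed.

Lemma dotBl f g h : dot (fun x => f x - g x) h = dot f h - dot g h.
Proof. by rewrite -sumrB; apply: eq_bigr => x _; rewrite mulrBl. Qed.

Lemma dotZl (c : R) f h : dot (fun x => c * f x) h = c * dot f h.
Proof. by rewrite mulr_sumr; apply: eq_bigr => x _; rewrite mulrA. Qed.

Lemma dot_suml (I : Type) (s : seq I) (F : I -> T -> R) h :
  dot (fun x => \sum_(i <- s) F i x) h = \sum_(i <- s) dot (F i) h.
Proof. by rewrite exchange_big; apply: eq_bigr => x _; rewrite mulr_suml. Qed.

Lemma dot_sumr (I : Type) (s : seq I) (F : I -> T -> R) h :
  dot h (fun x => \sum_(i <- s) F i x) = \sum_(i <- s) dot h (F i).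
Proof. by rewrite dotC dot_suml; apply: eq_bigr => i _; rewrite dotC. Qed.

Lemma cauchy_schwarz_dot f g : dot f g ^+ 2 <= dot f f * dot g g.
Proof. by rewrite !dot_sqr; exact: cauchy_schwarz_sum. Qed.

End Dot.

(** * Powers of a symmetric positive contraction *)

Section SymmetricContraction.
Context {R : realFieldType} {T : finType} (A : (T -> R) -> T -> R).
Context (A_sym : forall f g, dot (A f) g = dot f (A g)).
Context (A_contr : forall f, dot (A f) (A f) <= dot f f).
Context (A_ge0 : forall f, (forall x, 0 <= f x) -> forall x, 0 <= A f x).

Lemma dot_iterl n f g : dot (iter n A f) g = dot f (iter n A g).
Proof. by elim: n f g => //= n IH f g; rewrite A_sym IH -iterSr. Qed.

Lemma dot_iter m n f g : dot (iter m A f) (iter n A g) = dot (iter (m + n) A f) g.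
Proof. by rewrite addnC iterD [RHS]dot_iterl. Qed.

Lemma iter_contr n f : dot (iter n A f) (iter n A f) <= dot f f.
Proof. by elim: n => //= n IH; exact: le_trans (A_contr _) IH. Qed.

Lemma iter_ge0 n f : (forall x, 0 <= f x) -> forall x, 0 <= iter n A f x.
Proof. by move=> f0; elim: n => //= n IH; exact: A_ge0. Qed.

(** This is S_k of the overview, with P = A^2. Doubling the exponents makes <P^c f, f> = |A^c f|^2
    nonnegative, which [increment_sum] exploits. *)
Definition cesaro k (f : T -> R) (x : T) : R :=
  (2 ^+ k)^-1 * \sum_(c < 2 ^ k) iter c.*2 A f x.

Lemma cesaro_ge0 k f : (forall x, 0 <= f x) -> forall x, 0 <= cesaro k f x.
Proof.
move=> f0 x; rewrite mulr_ge0 ?invr_ge0 ?exprn_ge0//.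
by apply: sumr_ge0 => c _; exact: iter_ge0.
Qed.

Lemma dot_cesarol k f g :
  dot (cesaro k f) g = (2 ^+ k)^-1 * \sum_(c < 2 ^ k) dot (iter c.*2 A f) g.
Proof. by rewrite dotZl dot_suml. Qed.

Lemma cesaro_sym k f g : dot (cesaro k f) g = dot f (cesaro k g).
Proof.
rewrite [RHS]dotC !dot_cesarol; congr (_ * _); apply: eq_bigr => c _.
by rewrite dot_iterl dotC.
Qed.

Lemma cesaro_contr k f : dot (cesaro k f) (cesaro k f) <= dot f f.
Proof.
have k0 : 0 < 2 ^+ k :> R by rewrite exprn_gt0.
rewrite dot_sqr.
have E x : cesaro k f x ^+ 2 <= (2 ^+ k)^-1 * \sum_(c < 2 ^ k) iter c.*2 A f x ^+ 2.
  rewrite exprMn [X in X * _ <= _]expr2 -mulrA ler_wpM2l ?invr_ge0 ?(ltW k0)//.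
  rewrite ler_pdivrMl//; apply: le_trans (sqr_sum_le _ _) _.
  by rewrite /index_enum -enumT size_enum_ord natrX.
apply: le_trans (ler_sum _ (fun x _ => E x)) _.
rewrite -mulr_sumr exchange_big/= ler_pdivrMl//.
apply: (@le_trans _ _ (\sum_(c < 2 ^ k) dot f f)).
  by apply: ler_sum => c _; rewrite -dot_sqr iter_contr.
by rewrite sumr_const card_ord -[leLHS]mulr_natl natrX.
Qed.

(** For a < 2^j the mean P^a S_k runs over the exponents in [a, a + 2^k), a window inside [0,
    2^(k+1)). Positivity allows the missing exponents to be added; the factor 2 corrects the
    normalization. *)
Lemma cesaro_mul j k f g : (j <= k)%N ->
  (forall x, 0 <= f x) -> (forall x, 0 <= g x) ->
  dot (cesaro j f) (cesaro k g) <= 2 * dot (cesaro k.+1 f) g.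
Proof.
move=> jk f0 g0.
have j0 : 0 < 2 ^+ j :> R by rewrite exprn_gt0.
have k0 : 0 < 2 ^+ k :> R by rewrite exprn_gt0.
rewrite dot_cesarol ler_pdivrMl//.
apply: (@le_trans _ _ (\sum_(c < 2 ^ j) 2 * dot (cesaro k.+1 f) g)); last first.
  by rewrite sumr_const card_ord -[leLHS]mulr_natl natrX.
apply: ler_sum => a _.
rewrite dotC !dot_cesarol exprS invfM !mulrA divff ?pnatr_eq0// mul1r.
rewrite ler_wpM2l ?invr_ge0 ?(ltW k0)//.
under eq_bigr do rewrite dotC dot_iter -doubleD.
rewrite -(big_mkord xpredT (fun c => dot (iter c.*2 A f) g)).
rewrite -(big_mkord xpredT (fun c => dot (iter (a + c).*2 A f) g)).
have -> : \sum_(0 <= i < 2 ^ k) dot (iter (a + i).*2 A f) g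
   = \sum_(a <= i < a + 2 ^ k) dot (iter i.*2 A f) g.
  by rewrite -{2}[nat_of_ord a]add0n big_addn addKn; apply: eq_bigr => i _; rewrite addnC.
have ak : (a + 2 ^ k <= 2 ^ k.+1)%N.
  rewrite expnS mul2n -addnn leq_add2r; apply: ltnW; apply: leq_trans (ltn_ord a) _.
  by rewrite leq_exp2l.
rewrite (big_cat_nat _ ak)//= (@big_cat_nat _ _ _ a 0 (a + 2 ^ k)) ?leq_addr//=.
rewrite -addrA addrC -addrA lerDl addr_ge0//; apply: sumr_ge0 => i _;
  by apply: dot_ge0 => //; exact: iter_ge0.
Qed.

(** * Maximal function of the Cesaro means *)

Definition cesaro_maximal_bound K (u : R) := forall f (n : T -> nat),
  (forall x, 0 <= f x) -> (forall x, n x <= K)%N ->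
  \sum_x cesaro (n x) f x ^+ 2 <= u * dot f f.

(** Replacing the maximum by the sum over all k gives a constant that depends on [K], but a finite
    one, from which the descent in [cesaro_maximal] can start. *)
Lemma cesaro_maximal_bound_trivial K : cesaro_maximal_bound K K.+1%:R.
Proof.
move=> f n f0 nK.
apply: (@le_trans _ _ (\sum_x \sum_(k < K.+1) cesaro k f x ^+ 2)).
  apply: ler_sum => x _.
  have nxK : (n x < K.+1)%N by rewrite ltnS.
  rewrite (bigD1 (Ordinal nxK))//= lerDl.
  by apply: sumr_ge0 => k _; exact: sqr_ge0.
rewrite exchange_big/=.
apply: (@le_trans _ _ (\sum_(k < K.+1) dot f f)).
  by apply: ler_sum => k _; rewrite -dot_sqr cesaro_contr.
by rewrite sumr_const card_ord mulr_natl.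
Qed.

(* TT* argument: n linearizes the supremum, h below is the adjoint of
   f |-> cesaro (n x) f x applied to g, and cesaro_mul bounds its norm by the
   maximal function of g. The step decreases any admissible constant u >= 24,
   as 16 (u + 1) <= (u - 4)^2. *)
Lemma cesaro_maximal_bound_step K u : 24 <= u ->
  cesaro_maximal_bound K u -> cesaro_maximal_bound K (u - 4).
Proof.
move=> u24 Bu f n f0 nK.
set g := fun x => cesaro (n x) f x.
have g0 x : 0 <= g x by exact: cesaro_ge0.
set G := \sum_x _; have GE : G = dot g g by rewrite dot_sqr.
pose gk (k : nat) x := if n x == k then g x else 0.
have gk0 k x : 0 <= gk k x by rewrite /gk; case: ifP.
pose h x := \sum_(k < K.+1) cesaro k (gk k) x.
have sumgk (F : nat -> T -> R) x : \sum_(k < K.+1) gk k x * F k x = g x * F (n x) x.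
  have nxK : (n x < K.+1)%N by rewrite ltnS.
  rewrite (bigD1 (Ordinal nxK))//= /gk eqxx big1 ?addr0// => k nk.
  by rewrite ifN ?mul0r//; apply: contra nk => /eqP nk; apply/eqP/val_inj.
have sumdot (F : nat -> T -> R) :
    \sum_(k < K.+1) dot (gk k) (F k) = dot g (fun x => F (n x) x).
  by rewrite exchange_big/=; apply: eq_bigr => x _; rewrite sumgk.
have hf : dot h f = G.
  rewrite GE dot_suml/=; under eq_bigr do rewrite cesaro_sym.
  exact: (sumdot (fun k => cesaro k f)).
pose M := dot g (fun x => cesaro (n x).+1 g x).
have sumE : \sum_(k < K.+1) \sum_(j < K.+1) dot (cesaro k.+1 (gk j)) (gk k) = M.
  transitivity (\sum_(k < K.+1) dot (gk k) (cesaro k.+1 g)); last first.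
    exact: (sumdot (fun k => cesaro k.+1 g)).
  apply: eq_bigr => k _.
  under eq_bigr do rewrite cesaro_sym.
  rewrite -dot_suml -[RHS]cesaro_sym [RHS]dotC; apply: eq_bigr => x _; congr (_ * _).
  have := sumgk (fun _ _ => 1) x; rewrite mulr1 => <-.
  by apply: eq_bigr => i _; rewrite mulr1.
have hh : dot h h <= 4 * M.
  rewrite dot_suml; under eq_bigr do rewrite dot_sumr.
  (* The larger of j and k decides which of the two summands is the bound. Keeping both for every
     pair makes each double sum equal to 2 M. *)
  apply: (@le_trans _ _ (\sum_(j < K.+1) \sum_(k < K.+1)
     (2 * dot (cesaro k.+1 (gk j)) (gk k) + 2 * dot (cesaro j.+1 (gk k)) (gk j)))).
    apply: ler_sum => j _; apply: ler_sum => k _.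
    have [jk|/ltnW kj] := leqP j k.
      apply: le_trans (cesaro_mul jk (gk0 _) (gk0 _)) _.
      by rewrite lerDl mulr_ge0// dot_ge0// => x; exact: cesaro_ge0.
    rewrite dotC; apply: le_trans (cesaro_mul kj (gk0 _) (gk0 _)) _.
    by rewrite lerDr mulr_ge0// dot_ge0// => x; exact: cesaro_ge0.
  under eq_bigr do rewrite big_split/=.
  rewrite big_split/= exchange_big/=.
  under eq_bigr do rewrite -mulr_sumr.
  by rewrite -!mulr_sumr sumE; lra.
have M0 : 0 <= M by apply: dot_ge0 => // x; exact: cesaro_ge0.
have MG : M ^+ 2 <= G * ((u + 1) * G).
  apply: le_trans (cauchy_schwarz_dot _ _) _.
  rewrite -GE ler_wpM2l//; first by rewrite GE dot_sqr_ge0.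
  rewrite mulrDl mul1r dot_sqr.
  (* The index [(n x).+1] exceeds [K] when [n x = K]; the extra term for [K.+1] covers that case and
     turns u into u + 1. *)
  apply: (@le_trans _ _ (\sum_x (cesaro (minn (n x).+1 K) g x ^+ 2 + cesaro K.+1 g x ^+ 2))).
    apply: ler_sum => x _; have := nK x; rewrite leq_eqVlt => /orP[/eqP ->|nxK].
      by rewrite lerDr sqr_ge0.
    by rewrite (minn_idPl nxK) lerDl sqr_ge0.
  rewrite big_split/= lerD//.
    by rewrite GE; apply: Bu => // x; rewrite geq_minr.
  by rewrite -dot_sqr GE cesaro_contr.
have F0 := dot_sqr_ge0 f; set F := dot f f in F0 *.
have G0 : 0 <= G by rewrite GE dot_sqr_ge0.
have hh0 := dot_sqr_ge0 h.
have G2 : G ^+ 2 <= 4 * M * F.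
  rewrite -hf; apply: le_trans (cauchy_schwarz_dot _ _) _.
  by rewrite ler_wpM2r.
have G4 : (G ^+ 2) ^+ 2 <= 16 * (u + 1) * F ^+ 2 * G ^+ 2.
  apply: (@le_trans _ _ ((4 * M * F) ^+ 2)).
    by rewrite ler_pXn2r// nnegrE ?sqr_ge0// !mulr_ge0.
  by have := ler_wpM2r (sqr_ge0 F) MG; rewrite !exprMn; lra.
have [->|Gn0] := eqVneq G 0; first by rewrite mulr_ge0//; lra.
have Gp : 0 < G ^+ 2 by rewrite exprn_gt0// lt_neqAle eq_sym Gn0.
have {}G4 : G ^+ 2 <= 16 * (u + 1) * F ^+ 2 by rewrite -(ler_pM2r Gp) -expr2.
apply: ler_of_sqr; first by rewrite mulr_ge0//; lra.
apply: le_trans G4 _; rewrite exprMn ler_wpM2r ?sqr_ge0//; nra.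
Qed.

(** The initial constant K + 1 <= 20 + 4 K is lowered by 4 in each of K steps. The last step starts
    at 24, the least value that the step admits. *)
Lemma cesaro_maximal K : cesaro_maximal_bound K 20.
Proof.
suff B m : cesaro_maximal_bound K (20 + 4 * m%:R) -> cesaro_maximal_bound K 20.
  apply: (B K) => f n f0 nK; apply: le_trans (cesaro_maximal_bound_trivial f0 nK) _.
  by rewrite ler_wpM2r ?dot_sqr_ge0// -natr1; have := ler0n R K; lra.
elim: m => [|m IH]; first by rewrite mulr0 addr0.
move=> Bm; apply: IH; have := cesaro_maximal_bound_step _ Bm.
rewrite -[m.+1%:R]natr1 (_ : 20 + 4 * (m%:R + 1) - 4 = 20 + 4 * m%:R); last by ring.
by apply; have := ler0n R m; lra.
Qed.

Lemma cesaro_argmax K f x :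
  exists k, (k <= K)%N /\ forall j, (j <= K)%N -> cesaro j f x <= cesaro k f x.
Proof.
case: (@Order.TotalTheory.arg_maxP _ _ _ (@ord0 K) xpredT (fun i => cesaro i f x)) => // k _ kP.
exists k; split; first by rewrite -ltnS.
move=> j jK; exact: (kP (Ordinal (jK : (j < K.+1)%N))).
Qed.

(** * Square function of the difference between Cesaro means and powers *)

Definition increment j (f : T -> R) x := iter j.*2 A f x - iter j.+1.*2 A f x.

(* Abel summation, as a j = dot (A^j f) (A^j f) is decreasing and convex. *)
Lemma increment_sum f J :
  \sum_(j < J) j.+1%:R * dot (increment j f) (increment j f) <= dot f f.
Proof.
pose a j := dot (iter j.*2 A f) f.
have aE m n : dot (iter m.*2 A f) (iter n.*2 A f) = a (m + n)%N.
  by rewrite dot_iter -doubleD.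
have a1E j : a j = dot (iter j A f) (iter j A f) by rewrite dot_iter addnn.
(* The second difference of [a] at j is |A^j f - A^(j+2) f|^2, whence convexity; at even indices it
   is the squared norm of an increment. *)
pose D j := a j - 2 * a j.+1 + a j.+2.
have DE j : D j = dot (fun x => iter j A f x - iter j.+2 A f x)
                      (fun x => iter j A f x - iter j.+2 A f x).
  rewrite dotBl dotC dotBl [X in _ = _ - X]dotC dotBl !dot_iter /D /a.
  by rewrite !addnS !addSn !doubleS -addnn; ring.
have D0 j : 0 <= D j by rewrite DE dot_sqr_ge0.
have sumD n : \sum_(j < n) j.+1%:R * D j = a 0%N - n.+1%:R * a n + n%:R * a n.+1.
  elim: n => [|n IH]; first by rewrite big_ord0; ring.
  by rewrite big_ord_recr/= IH /D -!natr1; ring.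
have decr n : a n.+1 <= a n by rewrite !a1E; exact: A_contr.
have sumDle n : \sum_(j < n) j.+1%:R * D j <= dot f f.
  rewrite sumD -natr1; have := decr n; have := ler0n R n.
  have : 0 <= a n by rewrite a1E dot_sqr_ge0.
  have -> : a 0%N = dot f f by [].
  by nra.
have incE j : dot (increment j f) (increment j f) = D j.*2.
  by rewrite DE.
apply: le_trans (sumDle J.*2).
under eq_bigr do rewrite incE.
elim: J => [|J IH]; first by rewrite !big_ord0.
rewrite doubleS !big_ord_recr/= -addrA lerD//.
apply: (@le_trans _ _ (J.*2.+1%:R * D J.*2)).
  by rewrite ler_wpM2r// ler_nat ltnS -addnn leq_addr.
by rewrite lerDl mulr_ge0.
Qed.

(** Summation by parts; divided by N = 2^k it expresses S_k f - P^(2^k) f through increments. *)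
Lemma sum_increment N f x :
  \sum_(c < N) iter c.*2 A f x - N%:R * iter N.*2 A f x
    = \sum_(j < N) j.+1%:R * increment j f x.
Proof.
elim: N => [|N IH]; first by rewrite !big_ord0 mul0r subrr.
rewrite !big_ord_recr -IH /increment -[N.+1%:R]natr1 /=. ring.
Qed.

(** Cauchy-Schwarz over 2^k terms costs a factor 2^k, which cancels one of the two normalizing
    factors. *)
Lemma cesaro_sub_power_sqr k f x :
  (cesaro k f x - iter (2 ^ k).*2 A f x) ^+ 2
    <= \sum_(j < 2 ^ k) (2 ^+ k)^-1 * j.+1%:R ^+ 2 * increment j f x ^+ 2.
Proof.
have k0 : 0 < 2 ^+ k :> R by rewrite exprn_gt0.
have -> : cesaro k f x - iter (2 ^ k).*2 A f x
    = (2 ^+ k)^-1 * \sum_(j < 2 ^ k) j.+1%:R * increment j f x.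
  by rewrite -sum_increment mulrBr natrX mulrA mulVf ?mul1r// lt0r_neq0.
under [leRHS]eq_bigr do rewrite -mulrA -exprMn.
rewrite -mulr_sumr exprMn [X in X * _ <= _]expr2 -mulrA ler_wpM2l ?invr_ge0 ?(ltW k0)//.
rewrite ler_pdivrMl//; apply: le_trans (sqr_sum_le _ _) _.
by rewrite /index_enum -enumT size_enum_ord natrX.
Qed.

(** After exchanging the sums, the index j collects (j+1)^2 times the sum of 2^(-k) over 2^k >= j +
    1. This is at most 2 (j+1), twice the weight in [increment_sum]. *)
Lemma square_function K f :
  \sum_x \sum_(k < K) (cesaro k f x - iter (2 ^ k).*2 A f x) ^+ 2 <= 2 * dot f f.
Proof.
pose I j := dot (increment j f) (increment j f).
have I0 j : 0 <= I j by exact: dot_sqr_ge0.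
apply: (@le_trans _ _ (\sum_(k < K) \sum_(j < 2 ^ k) (2 ^+ k)^-1 * j.+1%:R ^+ 2 * I j)).
  rewrite exchange_big/=; apply: ler_sum => k _.
  apply: le_trans (ler_sum _ (fun x _ => cesaro_sub_power_sqr k f x)) _.
  rewrite exchange_big/=; apply: ler_sum => j _.
  by rewrite -mulr_sumr -dot_sqr.
apply: (@le_trans _ _ (\sum_(j < 2 ^ K) 2 * (j.+1%:R * I j))); last first.
  by rewrite -mulr_sumr ler_wpM2l// increment_sum.
have widen (k : 'I_K) : \sum_(j < 2 ^ k) (2 ^+ k)^-1 * j.+1%:R ^+ 2 * I j
    = \sum_(j < 2 ^ K) (if (j.+1 <= 2 ^ k)%N then (2 ^+ k)^-1 else 0) * (j.+1%:R ^+ 2 * I j).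
  rewrite (big_ord_widen (2 ^ K) (fun j => (2 ^+ k)^-1 * j.+1%:R ^+ 2 * I j)) ?leq_exp2l// ?(ltnW (ltn_ord k))//.
  by rewrite big_mkcond; apply: eq_bigr => j _; case: ifP; rewrite ?mul0r ?mulrA.
under eq_bigr do rewrite widen.
rewrite exchange_big/=; apply: ler_sum => j _.
rewrite -mulr_suml -big_mkcond/= (_ : 2 * _ = 2 / j.+1%:R * (j.+1%:R ^+ 2 * I j)).
  by rewrite ler_wpM2r ?mulr_ge0 ?sqr_ge0//; exact: dyadic_tail_sum.
by rewrite expr2 !mulrA divfK ?pnatr_eq0.
Qed.

(** A majorant [Q] stands in for the supremum. Writing P^(2^k) f as S_k f minus the difference S_k f
    - P^(2^k) f gives the constant 44 = 2 * 20 + 2 * 2. *)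
Lemma even_power_maximal K f : (forall x, 0 <= f x) ->
  exists Q : T -> R, \sum_x Q x <= 44 * dot f f /\
    forall k x, (k < K)%N -> iter (2 ^ k).*2 A f x ^+ 2 <= Q x.
Proof.
move=> f0.
have [n /all_and2[nK nmax]] : exists n : T -> nat, forall x, (n x <= K)%N /\
    forall j, (j <= K)%N -> cesaro j f x <= cesaro (n x) f x.
  exact: (fin_all_exists (fun x => cesaro_argmax K f x)).
exists (fun x => 2 * cesaro (n x) f x ^+ 2
  + 2 * \sum_(k < K) (cesaro k f x - iter (2 ^ k).*2 A f x) ^+ 2); split.
  rewrite big_split/= -!mulr_sumr.
  have := cesaro_maximal f0 nK; have := square_function K f; lra.
move=> k x kK; rewrite (bigD1 (Ordinal kK))//=.
have : 0 <= \sum_(i < K | i != Ordinal kK) (cesaro i f x - iter (2 ^ i).*2 A f x) ^+ 2.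
  by apply: sumr_ge0 => i _; exact: sqr_ge0.
have := nmax x k (ltnW kK); have := cesaro_ge0 k f0 x.
move: (cesaro k f x) (cesaro (n x) f x) (iter _ A f x) => S Sn P S0 SSn.
have : S ^+ 2 <= Sn ^+ 2 by rewrite ler_pXn2r// nnegrE// (le_trans S0).
(* Here 2 S^2 + 2 (S - P)^2 - P^2 = (2 S - P)^2. *)
have := sqr_ge0 (2 * S - P); nra.
Qed.

End SymmetricContraction.

(** * The random walk and the lattice points of the ball *)

(** Translation is injective, so the left sum is a reindexed subsum of the right one. With [Phi]
    constant this compares cardinalities. As [s'] may have repetitions, the proof passes through
    [undup]. *)
Lemma ler_sum_translate (R : realFieldType) (V : zmodType) (s s' : seq V)
    (p p' : pred V) (v : V) (Phi : V -> R) :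
  uniq s -> (forall y, 0 <= Phi y) ->
  (forall y, y \in s -> p y -> (y + v \in s') && p' (y + v)) ->
  \sum_(y <- s | p y) Phi (y + v) <= \sum_(y <- s' | p' y) Phi y.
Proof.
move=> us Phi0 sub.
rewrite -big_filter -(big_map (fun y => y + v) xpredT Phi) -[leRHS]big_filter.
set t := map _ _; set t' := [seq y <- s' | p' y].
have ut : uniq t by rewrite map_inj_uniq ?filter_uniq//; exact: addIr.
have tt' : {subset t <= t'}.
  move=> _ /mapP[y + ->]; rewrite !mem_filter => /andP[py ys].
  by rewrite andbC sub.
apply: (@le_trans _ _ (\sum_(y <- undup t' | y \in t) Phi y)).
  rewrite -[leRHS]big_filter (perm_big [seq y <- undup t' | y \in t])//.
  apply: uniq_perm => //; first by rewrite filter_uniq ?undup_uniq.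
  move=> y; rewrite mem_filter mem_undup; case: (boolP (y \in t)) => //= yt.
  by rewrite tt'.
rewrite big_mkcond/=.
apply: (@le_trans _ _ (\sum_(y <- undup t') Phi y)).
  by apply: ler_sum => y _; case: ifP.
elim: t' {tt'} => [|y l IH] /=; first by rewrite !big_nil.
rewrite [leRHS]big_cons; case: ifP => _; last by rewrite big_cons lerD2l.
by apply: le_trans IH _; rewrite lerDr.
Qed.

(** * Sums of translations on a finite group *)

Section ShiftAverages.
Context {R : realFieldType} {G : finZmodType}.
Implicit Types F : G -> R.

Lemma dot_translate F (v : G) : dot (fun x => F (x - v)) (fun x => F (x - v)) = dot F F.
Proof. by rewrite /dot [RHS](reindex_inj (addIr (- v))). Qed.

(** Each translation is an isometry, so the operator norm of the sum is at most the number of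
    translations. *)
Lemma sum_translates_sqr (s : seq G) F :
  \sum_x (\sum_(v <- s) F (x - v)) ^+ 2 <= (size s)%:R ^+ 2 * dot F F.
Proof.
apply: (@le_trans _ _ (\sum_x (size s)%:R * \sum_(v <- s) F (x - v) ^+ 2)).
  by apply: ler_sum => x _; exact: sqr_sum_le.
rewrite -mulr_sumr expr2 -mulrA ler_wpM2l// exchange_big/=.
under eq_bigr do rewrite -dot_sqr dot_translate.
by rewrite big_const_seq count_predT iter_addr_0 mulr_natl.
Qed.

End ShiftAverages.

Local Notation unit_vector j := (delta_mx ord0 j).

(** * The simple random walk carried to a finite group *)

Section Walk.
Context {R : realFieldType} {G : finZmodType} {d : nat} (psi : {additive Zd d -> G}).
Implicit Types F : G -> R.

Definition walk F x : R := (2 * d%:R)^-1 *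
  \sum_(j < d) (F (x - psi (unit_vector j)) + F (x + psi (unit_vector j))).

Lemma walk_sym F1 F2 : dot (walk F1) F2 = dot F1 (walk F2).
Proof.
rewrite dotZl [RHS]dotC dotZl; congr (_ * _); rewrite !dot_suml.
apply: eq_bigr => j _; set v := psi _.
transitivity (dot (fun x => F1 (x - v)) F2 + dot (fun x => F1 (x + v)) F2).
  by rewrite -big_split; apply: eq_bigr => x _; rewrite mulrDl.
transitivity (dot (fun x => F2 (x - v)) F1 + dot (fun x => F2 (x + v)) F1); last first.
  by rewrite -big_split; apply: eq_bigr => x _; rewrite mulrDl.
rewrite addrC; congr (_ + _).
  rewrite /dot [RHS](reindex_inj (addIr v)).
  by apply: eq_bigr => x _; rewrite addrK mulrC.
rewrite /dot [LHS](reindex_inj (addIr v)).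
by apply: eq_bigr => x _; rewrite addrK mulrC.
Qed.

Lemma walk_ge0 F : (forall x, 0 <= F x) -> forall x, 0 <= walk F x.
Proof.
move=> F0 x; rewrite mulr_ge0 ?invr_ge0 ?mulr_ge0//.
by apply: sumr_ge0 => j _; rewrite addr_ge0.
Qed.

Lemma walk_le F1 F2 : (forall x, F1 x <= F2 x) -> forall x, walk F1 x <= walk F2 x.
Proof.
move=> F12 x; rewrite ler_wpM2l ?invr_ge0 ?mulr_ge0//.
by apply: ler_sum => j _; rewrite lerD.
Qed.

Lemma walkZ c F x : walk (fun z => c * F z) x = c * walk F x.
Proof.
rewrite /walk mulrCA; congr (_ * _); rewrite mulr_sumr.
by apply: eq_bigr => j _; rewrite mulrDr.
Qed.

Lemma walk_contr F : dot (walk F) (walk F) <= dot F F.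
Proof.
(* In dimension 0 the factor [(2 * d%:R)^-1] is 0 by convention, so [walk] vanishes. *)
have [d0|d0] := eqVneq d 0%N.
  have c0 : (2 * d%:R)^-1 = 0 :> R by rewrite d0 mulr0 invr0.
  by rewrite dotZl c0 mul0r dot_sqr_ge0.
pose s := [seq psi (unit_vector j) | j <- index_enum 'I_d]
          ++ [seq - psi (unit_vector j) | j <- index_enum 'I_d].
have sE x : walk F x = (2 * d%:R)^-1 * \sum_(v <- s) F (x - v).
  rewrite big_cat/= !big_map -big_split/=; congr (_ * _).
  by apply: eq_bigr => j _; rewrite opprK.
have d20 : 0 < 2 * d%:R :> R by rewrite mulr_gt0// ltr0n lt0n.
rewrite dot_sqr; under eq_bigr do rewrite sE exprMn.
rewrite -mulr_sumr exprVn ler_pdivrMl ?exprn_gt0//.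
apply: le_trans (sum_translates_sqr _ _) _.
by rewrite size_cat !size_map /index_enum -enumT size_enum_ord addnn -mul2n natrM.
Qed.

End Walk.

(** * Counting lattice points of the ball *)

Section LatticeBall.
Context {R : realType} {d : nat}.
Implicit Types (y : Zd d) (j : 'I_d) (N : nat).

Definition l1norm y : nat := \sum_j `|y ord0 j|%N.

Definition zball N : {fset Zd d} := fset_set (@lattice_ball R d N%:R).

Lemma mem_zball N y : (y \in zball N) = (l1norm y <= N)%N.
Proof.
rewrite in_fset_set; last exact: finite_lattice_ball.
have E : \sum_j `|map_mx intr y ord0 j| = (l1norm y)%:R :> R.
  by rewrite natr_sum; apply: eq_bigr => j _; rewrite mxE -intr_norm -abszE.
by apply/idP/idP; rewrite inE /lattice_ball /l1ball /= E ler_nat.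
Qed.

(** Only coordinate [j] changes; the additive form avoids truncated subtraction. *)
Lemma l1norm_add_unit y j (c : int) :
  (l1norm (y + c *: unit_vector j) + `|y ord0 j| = l1norm y + `|(y ord0 j + c)%R|)%N.
Proof.
rewrite /l1norm (bigD1 j)//= [in RHS](bigD1 j)//= !mxE !eqxx mulr1.
rewrite (eq_bigr (fun i => `|y ord0 i|%N)); first by rewrite addnC addnA addnAC.
by move=> i ij; rewrite !mxE (negPf ij) andbF mulr0 addr0.
Qed.

Lemma add_unitE y j (c : int) : (y + c *: unit_vector j) ord0 j = y ord0 j + c.
Proof. by rewrite !mxE !eqxx mulr1. Qed.

Lemma sum_ball_translate N M (p p' : pred (Zd d)) j (c : int) (Phi : Zd d -> R) :
  (forall y, 0 <= Phi y) ->
  (forall y, (l1norm y <= N)%N -> p y ->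
    (l1norm (y + c *: unit_vector j) <= M)%N && p' (y + c *: unit_vector j)) ->
  \sum_(y <- zball N | p y) Phi (y + c *: unit_vector j) <= \sum_(y <- zball M | p' y) Phi y.
Proof.
move=> Phi0 NM; apply: ler_sum_translate => //; first exact: fset_uniq.
by move=> y; rewrite !mem_zball; exact: NM.
Qed.

Definition ball_size N : R := #|` zball N|%:R.

Lemma ball_sizeE N : ball_size N = \sum_(y <- zball N) 1.
Proof. by rewrite big_const_seq count_predT iter_addr_0. Qed.

Lemma sum_nonzero_le y : \sum_(j | y ord0 j != 0) 1 <= (l1norm y)%:R :> R.
Proof.
rewrite big_mkcond natr_sum; apply: ler_sum => j _.
by case: ifP => // y0; rewrite ler1n absz_gt0.
Qed.

Lemma sum_zero_ge y : (d - l1norm y)%:R <= \sum_(j | y ord0 j == 0) 1 :> R.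
Proof.
have : \sum_(j | y ord0 j == 0) 1 + \sum_(j | y ord0 j != 0) 1 = d%:R :> R.
  transitivity (\sum_(j < d) 1 : R); last by rewrite sumr_const card_ord.
  by rewrite [RHS](bigID (fun j => y ord0 j == 0)).
have := sum_nonzero_le y; have : 0 <= \sum_(j | y ord0 j == 0) 1 :> R by exact: sumr_ge0.
have [yd|/ltnW/eqP ->//] := leqP (l1norm y) d; rewrite natrB//; lra.
Qed.

(** Double counting: a point of the smaller ball has at least d - N zero coordinates, each of which
    can be changed to 1 or -1. A point of the larger ball arises at most once from each of its
    nonzero coordinates, of which there are at most N + 1. *)
Lemma ball_size_succ N :
  2 * (d - N)%:R * ball_size N <= N.+1%:R * ball_size N.+1.
Proof.
have count c j : `|c|%N = 1%N ->
    \sum_(y <- zball N | y ord0 j == 0) 1 <= \sum_(y <- zball N.+1 | y ord0 j == c) 1 :> R.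
  move=> c1; apply: (@sum_ball_translate _ _ _ _ j c (fun=> 1)) => // y yN /eqP y0.
  rewrite add_unitE y0 add0r eqxx andbT.
  by have := l1norm_add_unit y j c; rewrite y0 add0r c1; lia.
apply: (@le_trans _ _ (\sum_j 2 * \sum_(y <- zball N | y ord0 j == 0) (1 : R))).
  rewrite -mulr_sumr -mulrA ler_wpM2l// ball_sizeE mulr_sumr.
  rewrite (exchange_big_dep xpredT)//= big_seq [leRHS]big_seq.
  apply: ler_sum => y; rewrite mem_zball mulr1 => yN.
  by apply: le_trans (sum_zero_ge y); rewrite ler_nat leq_sub2l.
apply: (@le_trans _ _ (\sum_j \sum_(y <- zball N.+1 | y ord0 j != 0) (1 : R))).
  apply: ler_sum => j _; rewrite mulr_natl mulr2n.
  apply: le_trans (lerD (count 1 j erefl) (count (- 1) j erefl)) _.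
  rewrite big_mkcond [X in _ + X]big_mkcond [leRHS]big_mkcond -big_split/=; apply: ler_sum => y _.
  have [->|_] := eqVneq (y ord0 j) 1; first by rewrite addr0.
  by have [->|_] := eqVneq (y ord0 j) (- 1); rewrite add0r//; case: ifP.
rewrite ball_sizeE mulr_sumr (exchange_big_dep xpredT)//= big_seq [leRHS]big_seq.
apply: ler_sum => y; rewrite mem_zball mulr1 => yN.
by apply: le_trans (sum_nonzero_le y) _; rewrite ler_nat.
Qed.

Lemma ball_size_gt0 N : 0 < ball_size N.
Proof.
rewrite ltr0n cardfs_gt0; apply/fset0Pn; exists 0.
by rewrite mem_zball /l1norm big1// => j _; rewrite mxE.
Qed.

(** Iteration of [ball_size_succ]. Divided by N!, the left side is 2^N binomial(d, N), the number of
    sparse vectors. *)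
Lemma ball_size_ge N : 2 ^+ N * (d ^_ N)%:R <= N`!%:R * ball_size N.
Proof.
elim: N => [|N IH].
  by rewrite ffactn0 fact0 !mul1r ler1n; have := ball_size_gt0 0; rewrite ltr0n.
rewrite exprS ffactnSr factS !natrM.
have := ler_wpM2l (ler0n R N`!) (ball_size_succ N).
have := ler_wpM2l (ler0n R (d - N)) IH.
set b := ball_size _; set b' := ball_size _; set a := _ `!%:R; set e := _%:R.
by set n := _.+1%:R; lra.
Qed.

Definition sparse N y := (l1norm y == N) && [forall j, (`|y ord0 j| <= 1)%N].

Lemma sparse_nonzero N y : sparse N y -> \sum_(j | y ord0 j != 0) 1 = N%:R :> R.
Proof.
move=> /andP[/eqP <- /forallP y1]; rewrite big_mkcond natr_sum.
apply: eq_bigr => j _; have := y1 j; case: eqP => [-> //|/eqP].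
by rewrite -absz_gt0; case: absz => [|[|]].
Qed.

(** A non-sparse point either lies in the ball of radius N or has a coordinate of modulus at least
    2. Moving that coordinate one unit towards 0 keeps it nonzero and lands in the smaller ball,
    where at most N coordinates are nonzero; hence N + 1. *)
Lemma non_sparse_size N :
  \sum_(y <- zball N.+1 | ~~ sparse N.+1 y) 1 <= N.+1%:R * ball_size N.
Proof.
have count j : \sum_(y <- zball N.+1 | (`|y ord0 j| > 1)%N) 1
    <= \sum_(y <- zball N | y ord0 j != 0) 1 :> R.
  apply: (@le_trans _ _ (\sum_(y <- zball N | 0 < y ord0 j) 1
                       + \sum_(y <- zball N | y ord0 j < 0) 1)); last first.
    rewrite big_mkcond [X in _ + X]big_mkcond [leRHS]big_mkcond -big_split/=; apply: ler_sum => y _.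
    by case: (ltgtP (y ord0 j) 0) => _; rewrite ?addr0 ?add0r.
  apply: (@le_trans _ _ (\sum_(y <- zball N.+1 | 1 < y ord0 j) 1
                       + \sum_(y <- zball N.+1 | y ord0 j < - 1) 1)).
    rewrite big_mkcond [X in _ <= X + _]big_mkcond [X in _ <= _ + X]big_mkcond -big_split/=; apply: ler_sum => y _.
    by do 3 case: ifP; rewrite ?addr0 ?add0r//; lia.
  apply: lerD.
    apply: (@sum_ball_translate _ _ _ _ j (-1) (fun=> 1)) => // y yN yj.
    rewrite add_unitE; have := l1norm_add_unit y j (-1).
    by move: (y ord0 j) yj => a ya E; apply/andP; split; lia.
  apply: (@sum_ball_translate _ _ _ _ j 1 (fun=> 1)) => // y yN yj.
  rewrite add_unitE; have := l1norm_add_unit y j 1.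
  by move: (y ord0 j) yj => a ya E; apply/andP; split; lia.
apply: (@le_trans _ _ (\sum_(y <- zball N.+1 | (l1norm y <= N)%N) 1
   + \sum_j \sum_(y <- zball N.+1 | (`|y ord0 j| > 1)%N) 1)).
  rewrite (exchange_big_dep xpredT)//= [X in X + _]big_mkcond -big_split/=.
  rewrite big_mkcond big_seq [leRHS]big_seq; apply: ler_sum => y.
  rewrite mem_zball => yN.
  have S0 : 0 <= \sum_(j < d | (1 < `|y ord0 j|)%N) 1 :> R by exact: sumr_ge0.
  case: ifP => sp; last by rewrite addr_ge0//; case: ifP.
  case: ifP => yN'; first by rewrite lerDl.
  move: sp; rewrite /sparse eqn_leq yN ltnNge yN'/= => /forallPn[j].
  by rewrite -ltnNge => yj; rewrite add0r (bigD1 j)//= lerDl sumr_ge0.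
rewrite -[N.+1%:R]natr1 mulrDl mul1r addrC lerD//.
  apply: le_trans (ler_sum _ (fun j _ => count j)) _.
  rewrite ball_sizeE mulr_sumr (exchange_big_dep xpredT)//= big_seq [leRHS]big_seq.
  apply: ler_sum => y; rewrite mem_zball mulr1 => yN.
  by apply: le_trans (sum_nonzero_le y) _; rewrite ler_nat.
rewrite ball_sizeE.
apply: (@ler_sum_translate _ (Zd d) _ _ _ _ 0 (fun=> 1)) => //; first exact: fset_uniq.
by move=> y _ yN; rewrite addr0 andbT mem_zball.
Qed.

End LatticeBall.

(** * Sparse vectors as endpoints of walks *)

Section SparseWalk.
Context {R : realType} {G : finZmodType} {d : nat} (psi : {additive Zd d -> G}).
Implicit Types F : G -> R.
Local Notation zball := (@zball R d).

(* Every sparse vector of norm N is the endpoint of N! walks of length N. *)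
Lemma sum_sparse_le N F x : (0 < d)%N -> (forall z, 0 <= F z) ->
  N`!%:R * \sum_(y <- zball N | sparse N y) F (x - psi y)
    <= (2 * d%:R) ^+ N * iter N (walk psi) F x.
Proof.
move=> d0 F0; elim: N x => [|N IH] x.
  rewrite !mul1r /=.
  apply: (@le_trans _ _ (\sum_(y <- [:: 0 : Zd d]) F (x - psi y))).
    under eq_bigr => y _ do rewrite -[y in psi y]addr0.
    apply: (@ler_sum_translate _ (Zd d) _ _ _ _ 0 (fun y => F (x - psi y))) => //.
      exact: fset_uniq.
    move=> y _ /andP[/eqP y0 _]; rewrite addr0 mem_seq1 andbT; apply/eqP/rowP => j.
    have : (`|y ord0 j| <= l1norm y)%N by rewrite /l1norm (bigD1 j)//= leq_addr.
    by rewrite y0 leqn0 absz_eq0 mxE => /eqP.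
  by rewrite big_seq1 raddf0 subr0.
pose S z := \sum_(y <- zball N | sparse N y) F (z - psi y).
(* Removing the last step [c *: unit_vector j] from such a vector leaves a sparse vector of norm
   N. *)
have step j (c : int) : `|c|%N = 1%N ->
    \sum_(y <- zball N.+1 | sparse N.+1 y && (y ord0 j == c)) F (x - psi y)
      <= S (x - psi (c *: unit_vector j)).
  move=> c1; have -> : \sum_(y <- zball N.+1 | sparse N.+1 y && (y ord0 j == c)) F (x - psi y)
     = \sum_(y <- zball N.+1 | sparse N.+1 y && (y ord0 j == c))
        F (x - psi (c *: unit_vector j) - psi (y + (- c) *: unit_vector j)).
    by apply: eq_bigr => y _; rewrite scaleNr raddfB/= opprB addrA subrK.
  apply: (@sum_ball_translate _ _ _ _ _ _ j (- c)
    (fun z => F (x - psi (c *: unit_vector j) - psi z))) => // y yN /andP[/andP[/eqP yN1 /forallP y1] /eqP yj].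
  have := l1norm_add_unit y j (- c); rewrite yj subrr absz0 addn0 c1 yN1 => E.
  have {}E : l1norm (y + - c *: unit_vector j) = N by apply/eqP; rewrite -eqSS -addn1 E.
  rewrite /sparse E leqnn eqxx/=; apply/forallP => i; rewrite !mxE eqxx/=.
  by case: eqP => [->|_]; rewrite ?mulr0 ?addr0// yj mulr1 subrr.
(* A sparse vector of norm N + 1 has N + 1 nonzero coordinates, each of which can serve as the last
   step. *)
have main : N.+1%:R * \sum_(y <- zball N.+1 | sparse N.+1 y) F (x - psi y)
    <= 2 * d%:R * walk psi S x.
  have d20 : 2 * d%:R != 0 :> R by rewrite mulf_neq0 ?pnatr_eq0// -lt0n.
  rewrite /walk mulrA divff// mul1r mulr_sumr.
  under eq_bigr => y /(sparse_nonzero (R := R)) <- do rewrite mulr_suml.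
  rewrite (exchange_big_dep xpredT)//=; apply: ler_sum => j _.
  under eq_bigr do rewrite mul1r.
  have := lerD (step j 1 erefl) (step j (- 1) erefl).
  rewrite scale1r scaleN1r raddfN opprK; apply: le_trans.
  rewrite big_mkcond [X in _ <= X + _]big_mkcond [X in _ <= _ + X]big_mkcond -big_split/=.
  apply: ler_sum => y _; case: (boolP (sparse _ _)) => /= [/andP[_ /forallP y1]|_]; last by rewrite addr0.
  case: eqP => [_|/eqP y0] /=; first by rewrite addr_ge0//; case: ifP.
  have [->|y_1] := eqVneq (y ord0 j) 1; first by rewrite addr0.
  have -> : y ord0 j = - 1 by have := y1 j; lia.
  by rewrite eqxx add0r.
rewrite factS mulnC natrM -mulrA.
apply: le_trans (ler_wpM2l (ler0n _ _) main) _.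
rewrite mulrCA -walkZ exprS -[leRHS]mulrA ler_wpM2l ?mulr_ge0//= -walkZ.
exact: walk_le.
Qed.

End SparseWalk.

(** The product of 1 - i/d over i < N is at least 1 minus the sum of the i/d; here that inequality
    is multiplied by 2 d^(N+1). *)
Lemma ffact_bernoulli (R : realFieldType) d N : (N <= d)%N ->
  d%:R ^+ N * (2 * d%:R - N%:R * (N%:R - 1)) <= 2 * d%:R * (d ^_ N)%:R :> R.
Proof.
elim: N => [|N IH] Nd; first by rewrite ffactn0 mul0r subr0 mul1r mulr1.
rewrite ffactnSr natrM natrB ?(ltnW Nd)// -[N.+1%:R]natr1 exprSr.
have Nd' : N%:R <= d%:R :> R by rewrite ler_nat ltnW.
have dN0 : 0 <= d%:R - N%:R :> R by rewrite subr_ge0.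
have {IH dN0} := ler_wpM2r dN0 (IH (ltnW Nd)).
have P0 : 0 <= d%:R ^+ N * (N%:R * (N%:R * (N%:R - 1))) :> R.
  rewrite mulr_ge0 ?exprn_ge0// mulr_ge0//.
  by case: N {Nd Nd'} => [|N]; rewrite ?mul0r// mulr_ge0// subr_ge0 ler1n.
by move: P0; move: (d%:R ^+ N) (d ^_ N)%:R => P f; nra.
Qed.

(** The condition N^2 <= d, which is t <= sqrt d squared, gives 2 d - N (N - 1) >= d. *)
Lemma ffact_ge (R : realFieldType) d N : (N ^ 2 <= d)%N ->
  d%:R ^+ N <= 2 * (d ^_ N)%:R :> R.
Proof.
move=> Nd; have [d0|d0] := posnP d.
  have -> : N = 0%N by nia.
  by rewrite ffactn0 mulr1 expr0 ler1n.
have {}d0 : 0 < d%:R :> R by rewrite ltr0n.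
have Nd' : (N <= d)%N by nia.
have := ffact_bernoulli R Nd'.
have N2 : N%:R ^+ 2 <= d%:R :> R by rewrite -natrX ler_nat.
have P0 : 0 <= d%:R ^+ N :> R by exact: exprn_ge0.
move=> H; rewrite -(ler_pM2l d0); apply: le_trans (_ : _ <= 2 * d%:R * (d ^_ N)%:R) _; last by lra.
apply: le_trans H; rewrite mulrC ler_wpM2l//.
by have := ler0n R N; lra.
Qed.

(** A geometric sum is controlled by its largest term, here at most d. With N = 2^(k+1), this sums
    the errors N^2 / d. *)
Lemma sum_pow4_le (R : realFieldType) d K :
  \sum_(k < K | (4 ^ k.+1 <= d)%N) (4 ^ k.+1)%:R <= 2 * d%:R :> R.
Proof.
have S n : \sum_(k < n) (4 ^ k.+1)%:R <= 2 * (4 ^ n)%:R :> R.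
  elim: n => [|n IH]; first by rewrite big_ord0.
  rewrite big_ord_recr/= expnS natrM; have := ler0n R (4 ^ n); lra.
elim: K => [|K IH]; first by rewrite big_ord0 mulr_ge0.
rewrite big_mkcond big_ord_recr/= -big_mkcond/=; case: ifP => Kd; last by rewrite addr0.
apply: (@le_trans _ _ (2 * (4 ^ K.+1)%:R)); last by rewrite ler_wpM2l// ler_nat.
apply: le_trans (S K.+1); rewrite big_ord_recr/= lerD2r big_mkcond.
by apply: ler_sum => k _; case: ifP.
Qed.

(** * Ball averages on the finite group *)

Section BallAverage.
Context {R : realType} {G : finZmodType} {d : nat} (psi : {additive Zd d -> G}).
Implicit Types F : G -> R.
Local Notation zball := (@zball R d).
Local Notation ball_size := (@ball_size R d).

Definition ball_average N F x : R :=
  (ball_size N)^-1 * \sum_(y <- zball N) F (x - psi y).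

(** This is E_N of the overview, normalized by the size of the whole ball. *)
Definition non_sparse_average N F x : R :=
  (ball_size N)^-1 * \sum_(y <- zball N | ~~ sparse N y) F (x - psi y).

Lemma ball_average_contr N F : \sum_x ball_average N F x ^+ 2 <= dot F F.
Proof.
have b0 := ball_size_gt0 (R := R) (d := d) N.
under eq_bigr do rewrite exprMn.
rewrite -mulr_sumr exprVn ler_pdivrMl ?exprn_gt0//.
have := sum_translates_sqr (map psi (zball N)) F.
by under eq_bigr do rewrite big_map; rewrite size_map.
Qed.

Lemma ball_average_ge0 N F : (forall x, 0 <= F x) -> forall x, 0 <= ball_average N F x.
Proof. by move=> F0 x; rewrite mulr_ge0 ?invr_ge0// sumr_ge0. Qed.

Lemma ball_average_psi N F x :
  ball_average N F (psi x) = (ball_size N)^-1 * \sum_(y <- zball N) F (psi (x - y)).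
Proof. by congr (_ * _); apply: eq_bigr => y _; rewrite raddfB. Qed.

(** Counting paths puts the weight (2 d)^N / (N! |B_N|) in front of A^N. It is at most 2, as N!
    |B_N| >= 2^N d (d-1) ... (d-N+1) >= (2 d)^N / 2. *)
Lemma ball_average_le N F x : (0 < d)%N -> (N ^ 2 <= d)%N -> (forall z, 0 <= F z) ->
  ball_average N F x <= 2 * iter N (walk psi) F x + non_sparse_average N F x.
Proof.
move=> d0 Nd F0; have b0 := ball_size_gt0 (R := R) (d := d) N.
rewrite /ball_average (bigID (sparse N))/= mulrDr lerD2r ler_pdivrMl//.
have f0 : 0 < N`!%:R :> R by rewrite ltr0n fact_gt0.
rewrite -(ler_pM2l f0); apply: le_trans (sum_sparse_le psi N x d0 F0) _.
rewrite !mulrA ler_wpM2r//; first by apply: iter_ge0 => //; exact: walk_ge0.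
rewrite exprMn; have := ball_size_ge (R := R) (d := d) N.
have := ler_wpM2l (exprn_ge0 N (ler0n R 2)) (ffact_ge R Nd); lra.
Qed.

Lemma non_sparse_average_sqr N F : (0 < N)%N -> (N ^ 2 <= d)%N ->
  \sum_x non_sparse_average N F x ^+ 2 <= (N ^ 2)%:R / d%:R * dot F F.
Proof.
move=> N0 Nd; have b0 := ball_size_gt0 (R := R) (d := d) N.
have d0 : 0 < d%:R :> R by rewrite ltr0n; nia.
pose s := map psi [seq y <- zball N | ~~ sparse N y].
(* There are at most N |B_(N-1)| non-sparse points, and |B_(N-1)| <= (N / d) |B_N|. *)
have sle : (size s)%:R <= (N ^ 2)%:R / d%:R * ball_size N.
  have -> : (size s)%:R = \sum_(y <- zball N | ~~ sparse N y) 1 :> R.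
    by rewrite -big_filter big_const_seq count_predT iter_addr_0 size_map.
  case: N N0 Nd {s b0} => // N _ Nd.
  apply: le_trans (non_sparse_size (R := R) (d := d) N) _.
  have := ball_size_succ (R := R) (d := d) N.
  have Nd' : d%:R <= 2 * (d - N)%:R :> R.
    by rewrite -natrM ler_nat; nia.
  have bN := ball_size_gt0 (R := R) (d := d) N.
  move=> H; rewrite natrX mulrAC ler_pdivlMr//.
  have {}H := ler_wpM2l (ler0n R N.+1) H.
  have := ler_wpM2l (ler0n R N.+1) (ler_wpM2r (ltW bN) Nd').
  by lra.
have qle : (N ^ 2)%:R / d%:R <= 1 :> R by rewrite ler_pdivrMr// mul1r ler_nat.
have q0 : 0 <= (N ^ 2)%:R / d%:R :> R by rewrite divr_ge0// ltW.
under eq_bigr do rewrite exprMn.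
rewrite -mulr_sumr exprVn ler_pdivrMl ?exprn_gt0//.
have := sum_translates_sqr s F.
under eq_bigr do rewrite big_map big_filter.
move/le_trans; apply; rewrite mulrA ler_wpM2r ?dot_sqr_ge0//.
apply: (@le_trans _ _ (((N ^ 2)%:R / d%:R * ball_size N) ^+ 2)).
  by rewrite ler_pXn2r// nnegrE// mulr_ge0// ltW.
rewrite exprMn mulrC ler_wpM2l ?sqr_ge0//.
(* As q = N^2 / d is at most 1, q^2 <= q; the first power is still summable over dyadic N. *)
by rewrite expr2 ler_piMl.
Qed.

Lemma dyadic_ball_maximal F : (0 < d)%N -> (forall x, 0 <= F x) ->
  exists Q : G -> R, \sum_x Q x <= 1600 * dot F F /\
    forall n x, (4 ^ n <= d)%N -> ball_average (2 ^ n) F x ^+ 2 <= Q x.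
Proof.
move=> d0 F0.
have [Qp [Qp_sum Qp_ge]] := even_power_maximal (walk_sym psi) (walk_contr psi)
  (walk_ge0 psi) d F0.
have sqr4 k : ((2 ^ k) ^ 2)%N = (4 ^ k)%N by rewrite -expnM mulnC expnM.
pose E x := \sum_(k < d | (4 ^ k.+1 <= d)%N) non_sparse_average (2 ^ k.+1) F x ^+ 2.
have E0 x : 0 <= E x by apply: sumr_ge0 => k _; exact: sqr_ge0.
have E_sum : \sum_x E x <= 2 * dot F F.
  rewrite exchange_big/=.
  apply: (@le_trans _ _ (\sum_(k < d | (4 ^ k.+1 <= d)%N) (4 ^ k.+1)%:R / d%:R * dot F F)).
    apply: ler_sum => k kd; rewrite -sqr4; apply: non_sparse_average_sqr.
      by rewrite expn_gt0.
    by rewrite sqr4.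
  rewrite -!mulr_suml ler_wpM2r ?dot_sqr_ge0// ler_pdivrMr ?ltr0n//.
  exact: sum_pow4_le.
have Qp0 x : 0 <= Qp x by apply: le_trans (Qp_ge 0%N x d0); exact: sqr_ge0.
(* Radius 1 is not twice a dyadic integer and is bounded by contractivity alone. For the other radii
   (2 p + e)^2 <= 8 p^2 + 2 e^2, so the constant is 1 + 8 * 44 + 2 * 2 = 357, below 1600. *)
exists (fun x => ball_average 1 F x ^+ 2 + (8 * Qp x + 2 * E x)); split.
  rewrite !big_split/= -!mulr_sumr.
  have := ball_average_contr 1 F; have := dot_sqr_ge0 F; lra.
case=> [|k] x kd; first by rewrite lerDl addr_ge0// mulr_ge0.
have kd' : (k < d)%N by apply: leq_trans kd; apply: leq_trans (ltnW (ltn_expl k.+1 _)).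
apply: (@le_trans _ _ (8 * Qp x + 2 * E x)); last by rewrite lerDr sqr_ge0.
have N2 : ((2 ^ k.+1) ^ 2 <= d)%N by rewrite sqr4.
have := ball_average_le x d0 N2 F0; have := ball_average_ge0 (2 ^ k.+1) F0 x.
have := Qp_ge k x kd'.
have : non_sparse_average (2 ^ k.+1) F x ^+ 2 <= E x.
  by rewrite /E (bigD1 (Ordinal kd'))//= lerDl sumr_ge0// => i _; exact: sqr_ge0.
rewrite -[in iter _ _ _]mul2n -expnS.
move: (ball_average _ _ _) (iter _ _ _ _) (non_sparse_average _ _ _) => a p e eE pQ a0 ape.
have : a ^+ 2 <= (2 * p + e) ^+ 2 by rewrite ler_pXn2r// nnegrE// (le_trans a0).
by have := sqr_ge0 (2 * p - e); lra.
Qed.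

End BallAverage.

(** * Transference to the lattice *)

Lemma Cmod_ge0 (R : rcfType) (z : R[i]) : 0 <= Cmod z.
Proof. by case: z => a b; exact: sqrtr_ge0. Qed.

Lemma Cmod_real (R : rcfType) (a : R) : 0 <= a -> Cmod a%:C%C = a.
Proof. by move=> a0; rewrite /= expr0n addr0 sqrtr_sqr ger0_norm. Qed.

Lemma Cmod_sum_le (R : rcfType) (I : Type) (s : seq I) (f : I -> R[i]) :
  Cmod (\sum_(i <- s) f i) <= \sum_(i <- s) Cmod (f i).
Proof.
elim: s => [|i s IH]; first by rewrite !big_nil ComplexField.Normc.normc0.
by rewrite !big_cons; apply: le_trans (le_normcD _ _) _; rewrite lerD2l.
Qed.

Lemma average_le (R : realType) d N (f : Zd d -> R[i]) x :
  Cmod (average (N%:R : R) f x)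
    <= (ball_size (R := R) (d := d) N)^-1 * \sum_(y <- zball (R := R) N) Cmod (f (x - y)).
Proof.
rewrite /average fsbig_finite; last exact: finite_lattice_ball.
rewrite ComplexField.Normc.normcM ComplexField.Normc.normcV.
have -> (n : nat) : Cmod (n%:R : R[i]) = n%:R by rewrite -(rmorph_nat (real_complex R)) Cmod_real.
by rewrite ler_wpM2l ?invr_ge0//; exact: Cmod_sum_le.
Qed.

Lemma sup_sqr_le (R : realType) (S : set R) (q : R) :
  S !=set0%classic -> (forall v, S v -> 0 <= v /\ v ^+ 2 <= q) -> sup S ^+ 2 <= q.
Proof.
move=> [w Sw] Sq.
have [w0 wq] := Sq _ Sw; have q0 : 0 <= q by exact: le_trans (sqr_ge0 w) wq.
have ub v : S v -> v <= Num.sqrt q.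
  by move=> /Sq[_ vq]; apply: ler_of_sqr; rewrite ?sqrtr_ge0// sqr_sqrtr.
have s0 : 0 <= sup S.
  by apply: le_trans w0 _; apply: ub_le_sup => //; exists (Num.sqrt q) => v; exact: ub.
rewrite -(sqr_sqrtr q0) ler_pXn2r ?nnegrE ?sqrtr_ge0//.
by apply: ge_sup; [exists w|move=> v; exact: ub].
Qed.

Lemma dyadic_maximal_ge0 (R : realType) d (f : Zd d -> R[i]) x :
  (0 < d)%N -> 0 <= dyadic_maximal f x.
Proof.
move=> /(dyadic_maximal_has_sup f x)[[w Sw] ub].
by apply: le_trans (ub_le_sup ub Sw); case: Sw => t _ <-; exact: Cmod_ge0.
Qed.

(* The witness is the torus (Z / (2 c + 2))^d, with representatives in [- c, c + 1]. *)
Lemma finite_quotient d c : exists (G : finZmodType) (psi : {additive Zd d -> G}) (r : G -> Zd d),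
  injective r /\ forall z : Zd d, (forall i, (`|z ord0 i| <= c)%N) -> r (psi z) = z.
Proof.
(* The size 2 c + 2 exceeds 2 c, so residues of [-c, c] stay distinct, and it has the successor form
   under which the ordinals are a ring. *)
pose psi : {additive Zd d -> 'rV['I_(c.*2).+2]_d} := map_mx intr.
pose r (g : 'rV['I_(c.*2).+2]_d) : Zd d := \row_i ((g ord0 i + c%:R)%R%:Z - c%:Z).
exists 'rV['I_(c.*2).+2]_d, psi, r; split.
  move=> g h /rowP gh; apply/rowP => i; have := gh i; rewrite !mxE => /addIr/eqP.
  by rewrite eqz_nat => /eqP/val_inj/addIr.
move=> z zc; apply/rowP => i; rewrite !mxE (ord1 0); have := zc i; set a := z _ _ => ac.
have [k ak] : exists k : nat, a + c%:Z = k%:Z by exists `|(a + c%:Z)%R|%N; lia.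
rewrite -[c%:R]/(c%:Z%:~R) -intrD ak -[_%:~R]/(k%:R) Zp_nat /= modn_small; lia.
Qed.

(** The modulus of [f] is read on a finite quotient through representatives. At points of [E] its
    ball averages agree with those on Z^d, and [s] lists the representatives. *)
Lemma dyadic_maximal_sum_le (R : realType) d (f : Zd d -> R[i]) (E : {fset Zd d}) :
  (0 < d)%N ->
  exists2 s : seq (Zd d), uniq s &
    \sum_(x <- E) dyadic_maximal f x ^+ 2 <= 1600 * \sum_(x <- s) Cmod (f x) ^+ 2.
Proof.
move=> d0.
(* The margin [d] bounds every radius 2^n <= sqrt d, so x - y stays in the box for x in [E] and y in
   the ball. *)
have [c Ec] : exists c, forall x i, x \in E -> (`|x ord0 i| + d <= c)%N.
  exists (\sum_(x <- E) \sum_i `|x ord0 i| + d)%N => x i xE.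
  by rewrite leq_add2r (big_rem x)//= (bigD1 i)//= -addnA leq_addr.
have [G [psi [r [r_inj psiK]]]] := finite_quotient d c.
have Epsi x : x \in E -> r (psi x) = x.
  by move=> xE; apply: psiK => i; exact: leq_trans (leq_addr _ _) (Ec x i xE).
pose F g := Cmod (f (r g)).
have F0 g : 0 <= F g by exact: Cmod_ge0.
have [Q [Q_sum Q_ge]] := dyadic_ball_maximal psi d0 F0.
have Q0 g : 0 <= Q g by apply: le_trans (Q_ge 0%N g d0); exact: sqr_ge0.
have Q_max x : x \in E -> dyadic_maximal f x ^+ 2 <= Q (psi x).
  move=> xE; apply: sup_sqr_le.
    by have [] := dyadic_maximal_has_sup f x d0.
  move=> _ [_ [[n ->] nd] <-]; split; first exact: Cmod_ge0.
  have {}nd : (4 ^ n <= d)%N.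
    move: nd; rewrite -(ler_pXn2r (n := 2)) ?nnegrE ?sqrtr_ge0 ?exprn_ge0//.
    by rewrite sqr_sqrtr// -exprM mulnC exprM -natrX -natrX ler_nat.
  apply: le_trans (Q_ge n _ nd).
  rewrite ler_pXn2r ?nnegrE//; [|exact: Cmod_ge0|exact: ball_average_ge0].
  rewrite -natrX; apply: (le_trans (average_le (2 ^ n) f x)).
  rewrite ball_average_psi; apply: ler_wpM2l; first by rewrite invr_ge0 ltW ?ball_size_gt0.
  rewrite le_eqVlt; apply/orP; left; apply/eqP; apply: eq_big_seq => y.
  rewrite mem_zball => yN; rewrite /F psiK// => i.
  have nd2 : (2 ^ n <= d)%N by apply: leq_trans nd; rewrite -[4%N]/(2 * 2)%N expnMn leq_pmull ?expn_gt0.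
  have : (`|y ord0 i| <= d)%N.
    by apply: leq_trans nd2; apply: leq_trans yN; rewrite /l1norm (bigD1 i)//= leq_addr.
  have := Ec x i xE; rewrite !mxE; move: (x ord0 i) (y ord0 i) => a b; lia.
exists [seq r g | g <- enum G].
  by rewrite map_inj_uniq ?enum_uniq.
rewrite big_map big_enum/=.
apply: (@le_trans _ _ (\sum_g Q g)); last first.
  by apply: le_trans Q_sum _; rewrite dot_sqr.
apply: (@le_trans _ _ (\sum_(x <- E) Q (psi x))).
  by rewrite big_seq [leRHS]big_seq; apply: ler_sum => x xE; exact: Q_max.
rewrite -(big_map psi xpredT Q) big_uniq/=.
  by rewrite [leRHS](bigID (mem [seq psi x | x <- E]))/= lerDl sumr_ge0.
rewrite map_inj_in_uniq ?fset_uniq// => x y xE yE xy.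
by rewrite -(Epsi x xE) xy Epsi.
Qed.

Theorem theorem1p3 (R : realType) (d : nat) (hd : (4 <= d)%N)
  (f : Zd d -> R[i]) (hf : in_l2 f) :
  (l2norm (fun x => (dyadic_maximal f x)%:C%C) <= 40%:E * l2norm f)%E.
Proof.
have d0 : (0 < d)%N by exact: leq_trans hd.
have f0 : (0 <= \esum_(x in [set: Zd d]) ((Cmod (f x) ^+ 2)%:E))%E.
  by apply: esum_ge0 => x _; rewrite lee_fin sqr_ge0.
have c0 : (0 <= (1600 : R)%:E)%E by rewrite lee_fin; exact: ler0n.
have -> : (40%:E : \bar R) = sqrte 1600%:E.
  by rewrite /= (_ : 1600 = 40 ^+ 2) ?sqrtr_sqr ?ger0_norm//; ring.
rewrite -(sqrteM _ c0) lee_sqrt; last exact: mule_ge0.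
(* The infinite sum is a supremum over finite sets, so a bound for each finite set suffices. *)
apply: ub_ereal_sup => _ [A [finA _] <-].
rewrite fsbig_finite//.
have [s us sle] := dyadic_maximal_sum_le f (fset_set A) d0.
rewrite (eq_bigr (fun x => (dyadic_maximal f x ^+ 2)%:E)); last first.
  by move=> x _; rewrite Cmod_real// dyadic_maximal_ge0.
rewrite sumEFin; apply: (@le_trans _ _ ((1600 : R)%:E * (\sum_(x <- s) Cmod (f x) ^+ 2)%:E)%E).
  by rewrite -EFinM lee_fin.
rewrite lee_wpmul2l//; apply: esum_ge.
exists [set` s]%classic; first by split => //; exact: finite_seq.
by rewrite -sumEFin fsbig_seq.
Qed.
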